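(* Let $F$ be a finite field of characteristic two, let $n>2$ be an integer, and let $C_{2^n}=\langle a\rangle$ be the cyclic group of order $2^n$. Let $\sigma_3$ be the $F$-linear involution of $FC_{2^n}$ extending the group automorphism $a\mapsto a^{2^{n-1}-1}$. Then \[ |V_{\sigma_3}(FC_{2^n})|=|F|^{2^{n-1}}. \]
   Context: $FG$ denotes the group algebra of $G$ over $F$, and $V(FG)$ is the group of normalized units, i.e. units of $FG$ whose augmentation (sum of coefficients) equals $1$. For an involution $\sigma$ of $FG$, the unitary subgroup is $V_{\sigma}(FG)=\{u\in V(FG) : u^{\sigma}=u^{-1}\}$. *)

(* Defs.v *)
From HB Require Import structures.
From mathcomp Require Import all_boot all_order all_algebra all_fingroup all_field.

Set Implicit Arguments.
Unset Strict Implicit.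
Unset Printing Implicit Defensive.

Import GRing.Theory.
Local Open Scope ring_scope.

(* A fresh name for {ffun gT -> F}, so that the convolution product below does
   not clash with the library's pointwise ring structure on {ffun gT -> F}. *)
Definition group_algebra (F : fieldType) (gT : finGroupType) : Type :=
  {ffun gT -> F}.

Section GroupAlgebra.
Variables (F : fieldType) (gT : finGroupType).
Local Notation FG := (group_algebra F gT).
Implicit Types (x y z : FG) (g h k : gT).

HB.instance Definition _ := Vector.copy FG {ffun gT -> F^o}.

Definition coef_ga x g : F := (x : {ffun gT -> F}) g.

Definition ga_of g : FG := [ffun h => (h == g)%:R].

Definition mul_ga x y : FG :=
  [ffun g => \sum_h coef_ga x h * coef_ga y (h^-1 * g)%g].

Lemma coef_gaP x y : coef_ga x =1 coef_ga y -> x = y.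
Proof. by move=> eq_xy; apply/ffunP. Qed.

Lemma coef_gaD x y g : coef_ga (x + y) g = coef_ga x g + coef_ga y g.
Proof. by rewrite /coef_ga ffunE. Qed.

Lemma coef_gaZ c x g : coef_ga (c *: x) g = c * coef_ga x g.
Proof. by rewrite /coef_ga ffunE. Qed.

Lemma coef_ga_of g h : coef_ga (ga_of g) h = (h == g)%:R.
Proof. by rewrite /coef_ga ffunE. Qed.

Lemma coef_ga_mul x y g :
  coef_ga (mul_ga x y) g = \sum_h coef_ga x h * coef_ga y (h^-1 * g)%g.
Proof. by rewrite /coef_ga ffunE. Qed.

Fact mul_gaA : associative mul_ga.
Proof.
move=> x y z; apply: coef_gaP => g; rewrite !coef_ga_mul.
under eq_bigr do rewrite coef_ga_mul mulr_sumr.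
under [RHS]eq_bigr do rewrite coef_ga_mul mulr_suml.
rewrite [RHS]exchange_big; apply: eq_bigr => h _ /=.
rewrite [RHS](reindex_inj (mulgI h)) /=; apply: eq_bigr => k _.
by rewrite mulKg invMg mulgA mulrA.
Qed.

Fact mul_1ga : left_id (ga_of 1%g) mul_ga.
Proof.
move=> x; apply: coef_gaP => g; rewrite coef_ga_mul (bigD1 1%g) //= big1 => [|h].
  by rewrite coef_ga_of eqxx invg1 mul1g mul1r addr0.
by rewrite coef_ga_of => /negPf->; rewrite mul0r.
Qed.

Fact mul_ga1 : right_id (ga_of 1%g) mul_ga.
Proof.
move=> x; apply: coef_gaP => g; rewrite coef_ga_mul (bigD1 g) //= big1 => [|h].
  by rewrite coef_ga_of mulVg eqxx mulr1 addr0.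
by rewrite coef_ga_of -eq_mulVg1 => /negPf->; rewrite mulr0.
Qed.

Fact mul_gaDl : left_distributive mul_ga +%R.
Proof.
move=> x y z; apply: coef_gaP => g; rewrite coef_gaD !coef_ga_mul -big_split.
by apply: eq_bigr => h _; rewrite coef_gaD mulrDl.
Qed.

Fact mul_gaDr : right_distributive mul_ga +%R.
Proof.
move=> x y z; apply: coef_gaP => g; rewrite coef_gaD !coef_ga_mul -big_split.
by apply: eq_bigr => h _; rewrite coef_gaD mulrDr.
Qed.

Fact ga_of1_neq0 : ga_of 1%g != 0.
Proof.
apply/eqP => /(congr1 (coef_ga^~ 1%g)); rewrite coef_ga_of /coef_ga ffunE eqxx.
by move/eqP; rewrite oner_eq0.
Qed.

HB.instance Definition _ := GRing.Zmodule_isNzRing.Build FG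
  mul_gaA mul_1ga mul_ga1 mul_gaDl mul_gaDr ga_of1_neq0.

Fact scale_gaAl (c : F) x y : c *: (x * y) = c *: x * y.
Proof.
apply: coef_gaP => g; rewrite coef_gaZ !coef_ga_mul mulr_sumr.
by apply: eq_bigr => h _; rewrite coef_gaZ mulrA.
Qed.

HB.instance Definition _ := GRing.Lmodule_isLalgebra.Build F FG scale_gaAl.

Fact scale_gaAr (c : F) x y : c *: (x * y) = x * (c *: y).
Proof.
apply: coef_gaP => g; rewrite coef_gaZ !coef_ga_mul mulr_sumr.
by apply: eq_bigr => h _; rewrite coef_gaZ mulrCA.
Qed.

HB.instance Definition _ := GRing.Lalgebra_isAlgebra.Build F FG scale_gaAr.
HB.instance Definition _ := Algebra_isFalgebra.Build F FG.

Lemma ga_ofM g h : ga_of (g * h)%g = ga_of g * ga_of h.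
Proof.
apply: coef_gaP => k; rewrite coef_ga_mul (bigD1 g) //= big1 => [|l].
  by rewrite !coef_ga_of eqxx mul1r addr0 -(inj_eq (mulgI g) (g^-1 * k)%g) mulKVg.
by rewrite coef_ga_of => /negPf->; rewrite mul0r.
Qed.

Lemma ga_sum x : x = \sum_g coef_ga x g *: ga_of g.
Proof.
apply: coef_gaP => h; rewrite /coef_ga sum_ffunE (bigD1 h) //= big1 => [|g].
  by rewrite !ffunE eqxx [_ *: _]mulr1 addr0.
by rewrite !ffunE eq_sym => /negPf->; rewrite scaler0.
Qed.

Definition augmentation x : F := \sum_g coef_ga x g.

Definition linear_extension (f : gT -> gT) x : FG :=
  \sum_g coef_ga x g *: ga_of (f g).

Fact linear_extension_is_linear f : linear (linear_extension f).
Proof.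
move=> c x y; rewrite /linear_extension scaler_sumr -big_split.
by apply: eq_bigr => g _; rewrite coef_gaD coef_gaZ scalerDl scalerA.
Qed.

Lemma linear_extension_ga_of f g : linear_extension f (ga_of g) = ga_of (f g).
Proof.
rewrite /linear_extension (bigD1 g) //= big1 => [|h].
  by rewrite coef_ga_of eqxx scale1r addr0.
by rewrite coef_ga_of => /negPf->; rewrite scale0r.
Qed.

End GroupAlgebra.

HB.instance Definition _ (F : finFieldType) (gT : finGroupType) :=
  Finite.copy (group_algebra F gT) {ffun gT -> F}.

Section NormalizedUnits.
Variables (F : finFieldType) (gT : finGroupType).
Local Notation FG := (group_algebra F gT).

Definition normalized_units : {set FG} :=
  [set u : FG | (u \is a GRing.unit) && (augmentation u == 1)].

Definition unitary_subgroup (sigma : FG -> FG) : {set FG} :=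
  [set u in normalized_units | sigma u == u^-1].

End NormalizedUnits.

(* Main.v *)
From HB Require Import structures.
Require Import Defs.
From mathcomp Require Import all_boot all_order all_algebra all_fingroup all_field.
From mathcomp Require Import zify ring.

(** Let [m = 2 ^ (n - 1)], [x = 1 + a], and write [sigma] for the involution of
    the algebra [A], [tr z = z + sigma z], [N z = z * sigma z], [S] for the
    subring fixed by [sigma]. A normalized unit [u] is unitary when [N u = 1], so
    the task is to count the kernel of [N]. Put [s = N x] and [d = tr x].

    The algebra is local with nilpotent maximal ideal [x A], and [s] generates
    the same ideal as [x ^+ 2]. Therefore [A = S + x S], and so [tr A = d S].
    Everything rests on the identity [s + d = 1 + a ^+ m], whose square is zero:
    in characteristic two it says [s ^+ 2 = d ^+ 2]. For [p] in [S] it gives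
    [[
      N (1 + s p x) = 1 + s p d + s^3 p^2 = 1 + s d (p + d p^2),
    ]]
    and [p |-> p + d p^2] is a bijection of [S], being additive with trivial
    kernel because [d] is nilpotent. Hence [N (1 + s A)] contains
    [1 + tr (s A) = 1 + s d S], and a similar expansion gives the reverse
    inclusion. Comparing the multiplicative map [N] on [1 + s A] with the
    additive map [tr] on [s A], the two kernels have the same size
    ([card_norm1_ideal]): there are as many [u] in [1 + s A] with [N u = 1] as
    there are elements in [s A] fixed by [sigma].

    It remains to see that unitary units lie in [1 + s A]
    ([norm1_sub_ideal]), and that the fixed elements of [s A] are those of
    augmentation zero ([mem_fix_ideal]). The latter form a hyperplane in [S],
    whose dimension is the number [m + 1] of orbits of the involution on the
    group: it fixes [1] and [a ^+ m] only. *)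

Set Implicit Arguments.
Unset Strict Implicit.
Unset Printing Implicit Defensive.

Import GRing.Theory.

(** * Norm and trace of an involution in characteristic two *)

Lemma card_eq_fibres (T U : finType) (f : T -> U) (A : {set T}) (k : nat) :
    (forall x, x \in A -> #|[set y in A | f y == f x]| = k) ->
  #|A| = (#|f @: A| * k)%N.
Proof.
move=> fibre_k; rewrite -sum1_card (partition_big_imset f) /=.
rewrite -sum_nat_const; apply: eq_bigr => _ /imsetP[x Ax ->].
by rewrite -(fibre_k x Ax) -sum1_card; apply: eq_bigl => y; rewrite inE.
Qed.

Section NormTrace.
Local Open Scope ring_scope.
Variables (R : finComNzRingType) (sigma : {rmorphism R -> R}) (x : R).
Hypotheses (char2 : 2%N \in [pchar R]) (sigmaK : involutive sigma).

Definition trace (z : R) := z + sigma z.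
Definition norm (z : R) := z * sigma z.
Local Notation d := (trace x).
Local Notation s := (norm x).

Definition norm_ideal : {set R} := [set s * r | r : R].

Lemma sigma_trace z : sigma (trace z) = trace z.
Proof. by rewrite /trace rmorphD sigmaK addrC. Qed.

Lemma sigma_norm z : sigma (norm z) = norm z.
Proof. by rewrite /norm rmorphM sigmaK mulrC. Qed.

Lemma traceD y z : trace (y + z) = trace y + trace z.
Proof. by rewrite /trace rmorphD addrACA. Qed.

Lemma traceZ c z : sigma c = c -> trace (c * z) = c * trace z.
Proof. by move=> fix_c; rewrite /trace rmorphM fix_c mulrDr. Qed.

Lemma normM y z : norm (y * z) = norm y * norm z.
Proof. by rewrite /norm rmorphM mulrACA. Qed.

Lemma norm1D z : norm (1 + z) = 1 + trace z + norm z.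
Proof. by rewrite /norm /trace rmorphD rmorph1; ring. Qed.

Lemma norm_fix c : sigma c = c -> norm c = c ^+ 2.
Proof. by rewrite /norm => ->. Qed.

Lemma trace_eq0 z : (trace z == 0) = (sigma z == z).
Proof. by rewrite /trace addr_eq0 oppr_pchar2 // eq_sym. Qed.

(* In the application [x] generates the maximal ideal of a truncated polynomial
   algebra over a finite field [F], and [F + F x + (s)] is the whole ring since
   [s] is [x ^+ 2] up to a unit. *)
Hypothesis nil_s : exists k, s ^+ k = 0.
Hypothesis generated : forall r, exists p q r',
  [/\ sigma p = p, sigma q = q & r = p + x * q + s * r'].

(** Iterating the decomposition modulo [s] is legitimate because [s] itself is
    fixed by [sigma]; nilpotence of [s] kills the remainder. So the ring is
    generated by [1] and [x] over the fixed subring. *)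
Lemma fix_decomposition r :
  exists p q, [/\ sigma p = p, sigma q = q & r = p + x * q].
Proof.
have [k sk0] := nil_s.
suff [p [q [r' [fp fq ->]]]] : exists p q r',
    [/\ sigma p = p, sigma q = q & r = p + x * q + s ^+ k * r'].
  by exists p, q; rewrite sk0 mul0r addr0.
elim: k {sk0} => [|k [p [q [r' [fp fq ->]]]]].
  by exists 0, 0, r; rewrite !rmorph0 mulr0 expr0 mul1r !add0r.
have [p' [q' [r'' [fp' fq' ->]]]] := generated r'.
exists (p + s ^+ k * p'), (q + s ^+ k * q'), r''.
rewrite !rmorphD !rmorphM !rmorphXn /= !sigma_norm fp fq fp' fq'; split=> //.
by rewrite exprS; move: (norm x) => t; ring.
Qed.

Lemma trace_image r :
  exists2 q, sigma q = q & trace r = d * q.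
Proof.
have [p [q [fp fq ->]]] := fix_decomposition r; exists q => //.
by rewrite traceD (mulrC x) traceZ // /trace fp addrr_pchar2 // add0r mulrC.
Qed.

Hypotheses (sqr_d : d ^+ 2 = s ^+ 2) (s_dvd_d : d \in norm_ideal).

Lemma nil_ideal z : z \in norm_ideal -> exists k, z ^+ k = 0.
Proof.
by case/imsetP=> r _ ->; have [k sk0] := nil_s; exists k; rewrite exprMn sk0 mul0r.
Qed.

Lemma nil_multiple_eq0 z w : z \in norm_ideal -> w = z * w -> w = 0.
Proof.
case/nil_ideal=> k zk0 w_zw; suff -> : w = z ^+ k * w by rewrite zk0 mul0r.
elim: k {zk0} => [|k {1}->]; first by rewrite mul1r.
by rewrite {1}w_zw exprSr mulrA.
Qed.

Lemma idealM z r : z \in norm_ideal -> z * r \in norm_ideal.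
Proof. by case/imsetP=> t _ ->; rewrite -mulrA imset_f. Qed.

Lemma idealD y z :
  y \in norm_ideal -> z \in norm_ideal -> y + z \in norm_ideal.
Proof. by move=> /imsetP[r _ ->] /imsetP[t _ ->]; rewrite -mulrDr imset_f. Qed.

(** In characteristic two [p |-> p + d * p ^+ 2] is additive, and its kernel is
    trivial: [p = d * p ^+ 2] makes [p] a multiple of itself by the nilpotent
    [d * p]. An injective map of the finite fixed subring into itself is onto. *)
Lemma artin_schreier_surj q : sigma q = q ->
  exists2 p, sigma p = p & q = p + d * p ^+ 2.
Proof.
move=> fix_q; pose h p := p + d * p ^+ 2; pose S := [set p | sigma p == p].
have h_inj : injective h.
  move=> p p' eq_h; apply/eqP; rewrite -subr_eq0; apply/eqP.
  apply: (@nil_multiple_eq0 (d * (p - p'))); first exact: idealM.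
  have D : (p - p') + d * (p - p') ^+ 2
      = h p - h p' + (d * (p' ^+ 2 - p * p')) *+ 2.
    by rewrite /h; ring.
  rewrite eq_h subrr mulrn_pchar // addr0 in D.
  by rewrite -mulrA -expr2 -[LHS]oppr_pchar2 //; apply/eqP;
    rewrite eq_sym -addr_eq0 addrC D.
have hS : h @: S = S.
  apply/eqP; rewrite eqEcard card_imset // leqnn andbT.
  apply/subsetP=> _ /imsetP[p + ->]; rewrite inE => /eqP fp.
  by rewrite inE /h rmorphD rmorphM rmorphXn /= sigma_trace fp.
have : q \in h @: S by rewrite hS inE fix_q.
by case/imsetP=> p; rewrite inE => /eqP fp ->; exists p.
Qed.

(** Expanding the norm of [1 + s * r] leaves [s ^+ 2 * norm r] to be written as
    a trace from the ideal. With [r = p + x * q] this is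
    [s^2 p^2 + s^2 p q d + s^3 q^2]; the last two terms are fixed multiples of
    [s * d], since [s ^+ 2 = d ^+ 2], hence traces of multiples of [s * x]; and
    [s^2 p^2 = d^2 p^2] is the trace of [d p^2 x], which lies in the ideal
    because [s] divides [d]. *)
Lemma norm1_ideal_trace z : z \in norm_ideal ->
  exists2 y, y \in norm_ideal & norm (1 + z) = 1 + trace y.
Proof.
case/imsetP=> r _ ->; have [p [q [fp fq Dr]]] := fix_decomposition r.
have [r0 _ Dd] := imsetP s_dvd_d.
exists (s * (r + x * (s * p * q + d * q ^+ 2 + r0 * p ^+ 2))); first exact: imset_f.
rewrite norm1D -addrA; congr (_ + _); rewrite mulrDr traceD; congr (_ + _).
have -> : s * (x * (s * p * q + d * q ^+ 2 + r0 * p ^+ 2))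
   = (s * (s * p * q + d * q ^+ 2) + (s * r0) * p ^+ 2) * x by ring.
rewrite -Dd traceZ; last first.
  move: (sigma_norm x) (sigma_trace x) fp fq.
  move: (norm x) (trace x) => t e.
  by rewrite !(rmorphD, rmorphM, rmorphXn) /= => -> -> -> ->.
have Nr : norm r = p ^+ 2 + p * q * d + q ^+ 2 * s.
  by rewrite Dr /norm rmorphD rmorphM fp fq /trace; ring.
rewrite normM norm_fix ?sigma_norm // Nr.
have -> : s ^+ 2 * (p ^+ 2 + p * q * d + q ^+ 2 * s) =
  s ^+ 2 * p ^+ 2 + s ^+ 2 * p * q * d + s ^+ 2 * q ^+ 2 * s.
  by move: (norm x) (trace x) => t e; ring.
rewrite -{1}sqr_d -{2}sqr_d; move: (norm x) (trace x) => t e; ring.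
Qed.

(** The trace of an element of the ideal is [s * d * q] with [q] fixed, whereas
    [norm (1 + s * p * x) = 1 + s * d * (p + d * p ^+ 2)] for fixed [p]. *)
Lemma trace_ideal_norm1 y : y \in norm_ideal ->
  exists2 z, z \in norm_ideal & norm (1 + z) = 1 + trace y.
Proof.
case/imsetP=> r _ ->; rewrite traceZ ?sigma_norm //.
have [q fq ->] := trace_image r.
have [p fp ->] := artin_schreier_surj fq.
exists (s * (p * x)); first exact: imset_f.
rewrite norm1D !traceZ ?sigma_norm // (normM _ (p * x)) (normM p).
rewrite (norm_fix fp) (norm_fix (sigma_norm x)) -sqr_d.
by move: (norm x) (trace x) => t e; ring.
Qed.

Lemma inv_1_ideal z : z \in norm_ideal ->
  exists2 w, w - 1 \in norm_ideal & (1 + z) * w = 1.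
Proof.
move=> Jz; have [k zk0] := nil_ideal Jz.
pose w := \sum_(i < k) (- z) ^+ i; have zw1 : (1 + z) * w = 1.
  by apply: oppr_inj; rewrite -mulNr opprD addrC -subrX1 exprNn zk0 mulr0 sub0r.
exists w => //; suff -> : w - 1 = z * - w by exact: idealM.
by rewrite -zw1; ring.
Qed.

(** The norm on the group [1 + norm_ideal] and the trace on the additive group
    [norm_ideal] have images of the same size, by the two preceding lemmas, on
    domains of the same size. Hence their kernels have the same size. *)
Theorem card_norm1_ideal :
  #|[set u | (u - 1 \in norm_ideal) && (norm u == 1)]|
    = #|[set z in norm_ideal | sigma z == z]|.
Proof.
set E := [set u | _]; set K := [set z in _ | _].
pose f z := norm (1 + z).
have cardN : #|norm_ideal| = (#|f @: norm_ideal| * #|E|)%N.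
  apply: card_eq_fibres => y Jy.
  pose g u := (1 + y) * u - 1.
  have [w Jw yw] := inv_1_ideal Jy.
  have g_inj : injective g.
    by move=> u v /addIr /(congr1 ( *%R w)); rewrite !mulrA [w * _]mulrC yw !mul1r.
  rewrite -(card_imset E g_inj); apply: eq_card => z.
  apply/idP/imsetP => [|[u]]; rewrite !inE.
    case/andP=> Jz /eqP fz; exists (w * (1 + z)); last by rewrite /g mulrA yw; ring.
    rewrite inE normM -/(f z) fz -normM (mulrC w (1 + y)) yw /norm rmorph1.
    rewrite mulr1 eqxx andbT.
    suff -> : w * (1 + z) - 1 = w - 1 + z * w by rewrite idealD ?idealM.
    by ring.
  case/andP=> Ju /eqP Nu ->.
  rewrite /f /g (addrC 1 (_ - 1)) subrK normM Nu mulr1 eqxx andbT.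
  suff -> : (1 + y) * u - 1 = y * u + (u - 1) by rewrite idealD ?idealM.
  by ring.
have cardT : #|norm_ideal| = (#|trace @: norm_ideal| * #|K|)%N.
  apply: card_eq_fibres => y Jy.
  rewrite -(card_imset K (addrI y)); apply: eq_card => z.
  apply/idP/imsetP => [|[u]]; rewrite !inE.
    case/andP=> Jz /eqP trz.
    exists (y + z); last by rewrite addrA addrr_pchar2 // add0r.
    by rewrite !inE idealD //= -trace_eq0 traceD trz addrr_pchar2.
  case/andP=> Ju; rewrite -trace_eq0 => /eqP tru0 ->.
  by rewrite idealD //= traceD tru0 addr0.
have images : f @: norm_ideal = +%R 1 @: (trace @: norm_ideal).
  apply/setP=> v; apply/imsetP/imsetP.
    case=> z /norm1_ideal_trace[y Jy Ny] ->.
    by exists (trace y); rewrite ?imset_f.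
  case=> _ /imsetP[y Jy ->] ->.
  by have [z Jz Nz] := trace_ideal_norm1 Jy; exists z.
have img_gt0 : (0 < #|trace @: norm_ideal|)%N.
  by rewrite (cardD1 (trace (s * 0))) !imset_f.
move: cardN; rewrite images (card_imset _ (addrI 1)) cardT => /eqP.
by rewrite eqn_pmul2l // => /eqP.
Qed.
End NormTrace.

(** * Augmentation and induced involutions of a group algebra *)

Section Augmentation.
Local Open Scope ring_scope.
Variables (F : finFieldType) (gT : finGroupType).
Local Notation FG := (group_algebra F gT).

Lemma augmentationD (x y : FG) :
  augmentation (x + y) = augmentation x + augmentation y.
Proof.
by rewrite /augmentation -big_split; apply: eq_bigr => g _; rewrite coef_gaD.
Qed.

Lemma augmentationZ c (x : FG) : augmentation (c *: x) = c * augmentation x.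
Proof.
by rewrite /augmentation mulr_sumr; apply: eq_bigr => g _; rewrite coef_gaZ.
Qed.

Lemma augmentation_of g : augmentation (@ga_of F gT g) = 1.
Proof.
rewrite /augmentation (bigD1 g) //= big1 => [|h]; rewrite coef_ga_of ?eqxx ?addr0 //.
by move/negPf->.
Qed.

Lemma augmentationM (x y : FG) :
  augmentation (x * y) = augmentation x * augmentation y.
Proof.
rewrite /augmentation mulr_suml; under eq_bigr do rewrite coef_ga_mul.
rewrite exchange_big; apply: eq_bigr => h _ /=; rewrite mulr_sumr.
by rewrite (reindex_inj (mulgI h)); apply: eq_bigr => g _; rewrite mulKg.
Qed.

Lemma coef_linear_extension (f : gT -> gT) (x : FG) h : injective f ->
  coef_ga (linear_extension f x) (f h) = coef_ga x h.
Proof.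
move=> f_inj; rewrite /linear_extension /coef_ga sum_ffunE (bigD1 h) //= big1.
  by rewrite !ffunE eqxx addr0 [_ *: _]mulr1.
by move=> g /negPf ne_gh; rewrite !ffunE (inj_eq f_inj) eq_sym ne_gh scaler0.
Qed.

Lemma augmentation_linear_extension (f : gT -> gT) (x : FG) : injective f ->
  augmentation (linear_extension f x) = augmentation x.
Proof.
move=> f_inj; rewrite /augmentation (reindex_inj f_inj).
by apply: eq_bigr => g _; rewrite coef_linear_extension.
Qed.

Lemma linear_extension_fixP (f : gT -> gT) (x : FG) : injective f ->
  reflect (forall h, coef_ga x (f h) = coef_ga x h) (linear_extension f x == x).
Proof.
move=> f_inj; apply: (iffP eqP) => [fx h | fx].
  by rewrite -{1}fx coef_linear_extension.
apply: coef_gaP => g; have [f' _ f'K] := injF_bij f_inj.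
by rewrite -[g]f'K coef_linear_extension // fx.
Qed.

(** An element is fixed when its coefficients are constant on the orbits of [f];
    [k] is the number of these orbits. *)
Lemma card_linear_extension_fix (f : gT -> gT) k : involutive f ->
    (#|gT| + #|[set g | f g == g]| = k.*2)%N ->
  #|[set x : FG | linear_extension f x == x]| = (#|F| ^ k)%N.
Proof.
move=> fK card_k; have f_inj := inv_inj fK.
(* Comparing ranks in an enumeration of [gT] selects one point of each orbit:
   [A] and its preimage cover [gT] and meet in the fixed points. *)
pose A := [set g | enum_rank g <= enum_rank (f g)]%N.
have cardA : #|A| = k.
  have UA : A :|: f @^-1: A = setT.
    by apply/setP=> g; rewrite !inE fK leq_total.
  have IA : A :&: f @^-1: A = [set g | f g == g].
    apply/setP=> g; rewrite !inE fK -eqn_leq eq_sym.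
    by apply/eqP/eqP => [/ord_inj/enum_rank_inj | ->].
  have := cardsUI A (f @^-1: A); rewrite UA IA cardsT card_k card_preimset //.
  by rewrite addnn => /double_inj.
pose ext (u : {ffun gT -> F}) : FG := [ffun g => u (if g \in A then g else f g)].
have transv g : (if g \in A then g else f g) \in A.
  case: ifP => // /negbT; rewrite !inE fK -ltnNge; exact: ltnW.
rewrite -cardA -(card_pffun_on 0 (mem A) (mem F)).
have ext_inj : {in pffun_on 0 (mem A) (mem F) &, injective ext}.
  move=> u v /pffun_onP[/supportP u0 _] /pffun_onP[/supportP v0 _] eq_uv.
  apply/ffunP=> g; have [Ag|nAg] := boolP (g \in A); last by rewrite u0 ?v0.
  by have /ffunP/(_ g) := eq_uv; rewrite !ffunE Ag.
rewrite -(card_in_imset ext_inj); apply: eq_card => x.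
rewrite inE; apply/(linear_extension_fixP _ f_inj)/imsetP => [fx|[u _ ->] h].
  exists [ffun g => if g \in A then coef_ga x g else 0].
    apply/pffun_onP; split=> //; apply/supportP=> g nAg.
    by rewrite ffunE (negPf nAg).
  by apply/ffunP=> g; rewrite !ffunE transv; case: ifP => // _; rewrite fx.
rewrite /coef_ga !ffunE !inE fK; case: ltngtP => // /ord_inj/enum_rank_inj.
by move=> ->.
Qed.
End Augmentation.

Lemma autM (gT : finGroupType) (phi : {perm gT}) :
  phi \in Aut [set: gT] -> {morph phi : g h / (g * h)%g}.
Proof.
by move=> phi_aut g h; have /morphicP := Aut_morphic phi_aut; apply; rewrite inE.
Qed.

Lemma aut1 (gT : finGroupType) (phi : {perm gT}) :
  phi \in Aut [set: gT] -> phi 1%g = 1%g.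
Proof. by move=> /autM phiM; apply: (mulgI (phi 1%g)); rewrite -phiM !mulg1. Qed.

(** A copy of the group algebra whose type records that the group is abelian,
    so that the commutative ring structure can be inferred. *)
Definition abelian_algebra (F : finFieldType) (gT : finGroupType)
  (abG : abelian [set: gT]) : Type := group_algebra F gT.

Section AbelianAlgebra.
Local Open Scope ring_scope.
Variables (F : finFieldType) (gT : finGroupType) (abG : abelian [set: gT]).
Local Notation A := (abelian_algebra F abG).

HB.instance Definition _ := GRing.Algebra.copy A (group_algebra F gT).
HB.instance Definition _ := Finite.copy A (group_algebra F gT).

Fact mul_gaC : commutative (@mul_ga F gT).
Proof.
move=> x y; apply: coef_gaP => g; rewrite !coef_ga_mul.
rewrite (reindex_inj (inj_comp (mulgI g) invg_inj)) /=.
apply: eq_bigr => h _; rewrite mulrC invMg invgK mulgKV; congr (_ * coef_ga x _).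
by apply: (centsP abG); rewrite inE.
Qed.

HB.instance Definition _ := GRing.PzSemiRing_hasCommutativeMul.Build A mul_gaC.

Variables (phi : {perm gT}) (phi_aut : phi \in Aut [set: gT]).
Definition aut_extension of phi \in Aut [set: gT] : A -> A :=
  @linear_extension F gT phi.

HB.instance Definition _ := GRing.isLinear.Build F A A *:%R
  (aut_extension phi_aut) (@linear_extension_is_linear F gT phi).

Fact aut_extension_monoid : GRing.monoid_morphism (aut_extension phi_aut).
Proof.
have phiM := autM phi_aut; split=> [|x y].
  by rewrite [LHS]linear_extension_ga_of (aut1 phi_aut).
apply: coef_gaP => g; rewrite -[g](permKV phi).
rewrite coef_linear_extension; last exact: perm_inj.
rewrite !coef_ga_mul [RHS](reindex_inj (@perm_inj _ phi)); apply: eq_bigr => h _ /=.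
have -> : ((phi h)^-1 * phi (phi^-1 g) = phi (h^-1 * phi^-1 g))%g.
  by apply: (mulgI (phi h)); rewrite -phiM !mulKVg.
by rewrite !coef_linear_extension //; exact: perm_inj.
Qed.

HB.instance Definition _ := GRing.isMonoidMorphism.Build A A
  (aut_extension phi_aut) aut_extension_monoid.
End AbelianAlgebra.

(** * The cyclic 2-group *)

Section CyclicTwoGroup.
Local Open Scope ring_scope.
Variables (F : finFieldType) (n : nat) (gT : finGroupType) (a : gT).
Variables (abG : abelian [set: gT]).
Variables (phi : {perm gT}) (phi_aut : phi \in Aut [set: gT]).
Hypotheses (charF2 : 2%N \in [pchar F]) (n_gt2 : (2 < n)%N).
Hypotheses (gT_cycle : [set: gT] = <[a]>%g) (ord_a : #[a]%g = (2 ^ n)%N).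
Hypothesis phi_a : phi a = (a ^+ (2 ^ n.-1 - 1))%g.

Local Notation A := (abelian_algebra F abG).
Local Notation sigma := (aut_extension phi_aut : {rmorphism A -> A}).
Local Notation m := (2 ^ n.-1)%N.
Local Notation "''g' h" := (ga_of F h : A) (at level 8, h at level 2).
Local Notation x := (1 + 'g a).
Local Notation s := (norm sigma x).
Local Notation d := (trace sigma x).
Local Notation J := (norm_ideal sigma x).

(** This is where [n > 2] enters: the facts below about exponents become
    integer arithmetic in [k]. *)
Lemma half_order : exists2 k, (0 < k)%N & m = (4 * k)%N /\ (2 ^ n = 8 * k)%N.
Proof.
have [j ->] : exists j, n = j.+3 by exists (n - 3)%N; lia.
by exists (2 ^ j)%N; rewrite ?expn_gt0 //= !expnS; lia.
Qed.

Lemma gT_powers h : exists i, h = (a ^+ i)%g.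
Proof. by apply/cycleP; rewrite -gT_cycle inE. Qed.

Lemma phi_powers i : phi (a ^+ i)%g = (a ^+ ((m - 1) * i))%g.
Proof.
elim: i => [|i IHi]; first by rewrite muln0 expg0 (aut1 phi_aut).
by rewrite expgSr (autM phi_aut) IHi phi_a -expgD mulnSr.
Qed.

Lemma phiK : involutive phi.
Proof.
move=> h; have [i ->] := gT_powers h; rewrite !phi_powers.
apply/eqP; rewrite cyclic.eq_expg_mod_order ord_a.
have [k k_gt0 [-> ->]] := half_order.
have -> : ((4 * k - 1) * ((4 * k - 1) * i)
    = (2 * k - 1) * i * (8 * k) + i)%N by nia.
by rewrite modnMDl.
Qed.

Lemma card_phi_fix : #|[set h | phi h == h]| = 2.
Proof.
have -> : [set h | phi h == h] = [set 1%g; (a ^+ m)%g].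
  apply/setP=> h; rewrite !inE; have [i ->] := gT_powers h; rewrite phi_powers.
  rewrite -(expg0 a) !cyclic.eq_expg_mod_order ord_a.
  have [k k_gt0 [Dm ->]] := half_order.
  have -> : ((m - 1) * i == i %[mod 8 * k]) = (8 * k %| (4 * k - 2) * i)%N.
    rewrite Dm -[X in _ == X %[mod _]]add0n.
    have -> : ((4 * k - 1) * i = (4 * k - 2) * i + i)%N by nia.
    by rewrite eqn_modDr mod0n.
  have -> : (8 * k %| (4 * k - 2) * i)%N = (4 * k %| i)%N.
    have -> : ((4 * k - 2) * i = 2 * ((2 * k - 1) * i))%N by nia.
    have -> : (8 * k = 2 * (4 * k))%N by lia.
    rewrite dvdn_pmul2l // Gauss_dvdr //.
    rewrite -Dm coprimeXl // coprime2n; lia.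
  rewrite Dm mod0n (modn_small (_ : 4 * k < 8 * k)%N); last by lia.
  apply/idP/idP => [/dvdnP[q ->]|].
    have -> : (q * (4 * k) = q./2 * (8 * k) + odd q * (4 * k))%N.
      by rewrite -[q in LHS]odd_double_half; case: (odd q); lia.
    rewrite modnMDl modn_small; last by case: (odd q); lia.
    by case: (odd q); rewrite ?mul0n ?mul1n eqxx ?orbT.
  rewrite (divn_eq i (8 * k)) modnMDl modn_mod => /orP[] /eqP ->.
    by rewrite addn0; apply/dvdnP; exists (i %/ (8 * k) * 2)%N; lia.
  by apply/dvdnP; exists (i %/ (8 * k) * 2 + 1)%N; lia.
rewrite cards2 -(expg0 a) cyclic.eq_expg_mod_order ord_a.
have [k k_gt0 [-> ->]] := half_order.
by rewrite mod0n modn_small; lia.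
Qed.

Lemma charA2 : 2%N \in [pchar A].
Proof. by apply/andP; split; rewrite // -scaler_nat pcharf0 // scale0r. Qed.

Lemma ga_ofX h i : 'g (h ^+ i)%g = 'g h ^+ i.
Proof. by elim: i => [|i IHi] //; rewrite expgS exprS -IHi -ga_ofM. Qed.

Lemma sigmaK : involutive sigma.
Proof.
move=> z; apply: coef_gaP => h; rewrite -[h]phiK.
by rewrite !coef_linear_extension ?phiK //; exact: perm_inj.
Qed.

Lemma sigma_g : sigma ('g a) = 'g a ^+ (m - 1).
Proof. by rewrite [LHS]linear_extension_ga_of phi_a ga_ofX. Qed.

Lemma augmentation_x : augmentation x = 0.
Proof. by rewrite augmentationD !augmentation_of addrr_pchar2. Qed.

Lemma dvd_1X (y : A) i : exists r, 1 + y ^+ i = (1 + y) * r.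
Proof.
exists (\sum_(j < i) y ^+ j).
have addB (z : A) : 1 + z = z - 1 by rewrite oppr_pchar2 ?charA2 // addrC.
by rewrite !addB subrX1.
Qed.

Lemma augmentation0P (r : A) : augmentation r = 0 -> exists t, r = x * t.
Proof.
move=> r0; have -> : r = \sum_h coef_ga r h *: (1 + 'g h).
  rewrite (eq_bigr _ (fun h _ => scalerDr _ _ _)) big_split -scaler_suml /=.
  rewrite -/(augmentation r) r0 scale0r add0r; exact: ga_sum.
elim/big_ind: _ => [|y z [t ->] [u ->]|h _]; first by exists 0; rewrite mulr0.
  by exists (t + u); rewrite mulrDr.
have [i ->] := gT_powers h; rewrite ga_ofX; have [t ->] := dvd_1X ('g a) i.
by exists (coef_ga r (a ^+ i)%g *: t); rewrite scalerAr.
Qed.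

Lemma augmentation_sigma (z : A) : augmentation (sigma z) = augmentation z.
Proof. by apply: augmentation_linear_extension; exact: perm_inj. Qed.

Lemma augmentation_s : augmentation s = 0.
Proof. by rewrite /norm augmentationM augmentation_x mul0r. Qed.

Lemma augmentation_decomposition (r : A) :
  exists t, r = (augmentation r)%:A + x * t.
Proof.
have [|t Dt] := @augmentation0P (r - (augmentation r)%:A).
  rewrite augmentationD -scaleNr augmentationZ (augmentation_of F 1%g).
  by rewrite mulr1 subrr.
by exists t; rewrite -Dt addrC subrK.
Qed.

(** [sigma x] lies in the augmentation ideal, so it is [x * w]; applying [sigma]
    makes [x] a multiple of [sigma x], and [x * x] one of [x * sigma x]. *)
Lemma sqr_x_dvd : exists t, x ^+ 2 = s * t.
Proof.
have [|w Dw] := @augmentation0P (sigma x).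
  by rewrite augmentation_sigma augmentation_x.
by exists (sigma w); rewrite /norm -mulrA -rmorphM -Dw sigmaK.
Qed.

Lemma quadratic_decomposition (r : A) :
  exists b t, r = (augmentation r)%:A + b%:A * x + s * t.
Proof.
have [t {1}->] := augmentation_decomposition r.
have [u ->] := augmentation_decomposition t; have [w Dw] := sqr_x_dvd.
by exists (augmentation t), (w * u); rewrite mulrA -Dw; ring.
Qed.

Lemma s_add_d : s + d = 1 + 'g a ^+ m.
Proof.
have -> : 'g a ^+ m = 'g a * sigma ('g a).
  by rewrite sigma_g -exprS; congr (_ ^+ _); have := expn_gt0 2 n.-1; lia.
rewrite /norm /trace rmorphD rmorph1; move: (sigma _) => t.
transitivity (1 + 'g a * t + (1 + 'g a + t) *+ 2); first by ring.
by rewrite mulrn_pchar ?charA2 // addr0.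
Qed.

Lemma g_order : 'g a ^+ (2 ^ n) = 1.
Proof. by rewrite -ga_ofX -ord_a expg_order. Qed.

Lemma sqr_d : d ^+ 2 = s ^+ 2.
Proof.
have s_d0 : (s + d) ^+ 2 = 0.
  have [k _ [Dm D2n]] := half_order.
  rewrite s_add_d sqrrD expr1n mulrn_pchar ?charA2 // addr0 -exprM.
  rewrite (_ : m * 2 = 2 ^ n)%N; last by rewrite D2n Dm; lia.
  by rewrite g_order addrr_pchar2 ?charA2.
rewrite sqrrD mulrn_pchar ?charA2 // addr0 in s_d0.
by apply/eqP; rewrite -[s ^+ 2](oppr_pchar2 charA2) -addr_eq0 addrC s_d0.
Qed.

(** By [s_add_d] it is enough that [s] divides [1 + a ^+ m], which is a multiple
    of [1 + a ^+ 2 = x ^+ 2] because [m] is even. *)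
Lemma s_dvd_d : d \in J.
Proof.
have [k k_gt0 [Dm _]] := half_order; have [w Dw] := sqr_x_dvd.
have [r Dr] := dvd_1X ('g a ^+ 2) (2 * k).
apply/imsetP; exists (w * r - 1) => //; rewrite mulrBr mulr1 mulrA -Dw.
apply: (addrI s); rewrite s_add_d Dm (addrC s) subrK.
rewrite -exprM in Dr; rewrite (_ : 4 * k = 2 * (2 * k))%N ?Dr; last by lia.
by rewrite sqrrD mulrn_pchar ?charA2 // addr0 expr1n.
Qed.

Lemma nil_s : exists k, s ^+ k = 0.
Proof.
exists (2 ^ n)%N; suff x0 : x ^+ (2 ^ n) = 0 by rewrite /norm exprMn x0 mul0r.
rewrite exprDn_pchar ?expr1n ?g_order ?addrr_pchar2 ?charA2 //.
by rewrite pnatX pnatE // charA2.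
Qed.

Lemma sigma_scalar c : sigma c%:A = c%:A.
Proof.
transitivity (c *: sigma 1); last by rewrite rmorph1.
exact: (linearZ_LR (aut_extension phi_aut : {linear A -> A}) c 1).
Qed.

Lemma generated (r : A) : exists p q r',
  [/\ sigma p = p, sigma q = q & r = p + x * q + s * r'].
Proof.
have [b [t Dr]] := quadratic_decomposition r.
exists (augmentation r)%:A, b%:A, t; rewrite (mulrC x).
by rewrite !sigma_scalar.
Qed.

(** The two contributions to the coefficient at [1] are equal, since [phi] fixes
    [1]; the next lemma shows that this linear form does not vanish on [s]. *)
Lemma coef1_trace (y : A) : coef_ga (trace sigma y) 1%g = 0.
Proof.
rewrite coef_gaD -{2}(aut1 phi_aut).
by rewrite coef_linear_extension ?addrr_pchar2 //; exact: perm_inj.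
Qed.

Lemma coef1_s : coef_ga s 1%g = 1.
Proof.
rewrite -[LHS]addr0 -(coef1_trace x) -coef_gaD s_add_d coef_gaD -ga_ofX !coef_ga_of.
rewrite eqxx -(expg0 a) cyclic.eq_expg_mod_order ord_a.
have [k k_gt0 [-> ->]] := half_order.
rewrite mod0n modn_small; last by lia.
by rewrite (_ : (0 == 4 * k)%N = false) ?addr0 //; lia.
Qed.

(** [d ^+ 2 = a ^+ 2 + a ^- 2], and [a ^+ 4 != 1]. *)
Lemma sqr_d_neq0 : d ^+ 2 != 0.
Proof.
have -> : d ^+ 2 = 'g (a ^+ 2)%g + 'g (a ^+ ((m - 1) * 2))%g.
  rewrite /trace rmorphD rmorph1 sigma_g !ga_ofX exprM.
  move: ('g a ^+ (m - 1)) => t.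
  transitivity ('g a ^+ 2 + t ^+ 2 + (2%:R * (1 + 'g a + t) + 'g a * t) *+ 2).
    by ring.
  by rewrite mulrn_pchar ?charA2 // addr0.
apply/eqP=> /(congr1 (fun z => coef_ga z (a ^+ 2)%g)).
rewrite coef_gaD !coef_ga_of eqxx cyclic.eq_expg_mod_order ord_a.
have [k k_gt0 [-> ->]] := half_order.
rewrite (_ : (4 * k - 1) * 2 = 8 * k - 2)%N; last by lia.
rewrite !modn_small; [|lia|lia].
rewrite (_ : (2 == 8 * k - 2)%N = false) ?addr0 /coef_ga ?ffunE; last by lia.
by move/eqP; rewrite oner_eq0.
Qed.

(** Write [u = 1 + b * x + s * r]. Modulo the group [1 + J], [1 + b * x] equals
    [u], of norm one; so [norm (1 + b * x) = 1 + b * d + b ^+ 2 * s] is [1] plus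
    a trace, and comparing coefficients at [1] gives [b ^+ 2 = 0]. *)
Lemma norm1_sub_ideal (u : A) :
  augmentation u = 1 -> norm sigma u = 1 -> u - 1 \in J.
Proof.
move=> aug_u Nu; have [b [r]] := quadratic_decomposition u.
rewrite aug_u scale1r => Du.
suff b0 : b = 0 by rewrite Du b0 scale0r mul0r addr0 addrC addKr imset_f.
(* [1 + z] is [(1 + b * x) / u], as [sigma u] is the inverse of [u]. *)
pose z := s * - (r * sigma u).
have Jz : z \in J by exact: imset_f.
have Dz : 1 + z = sigma u * (1 + b%:A * x).
  have -> : 1 + b%:A * x = u - s * r by rewrite Du addrK.
  by rewrite mulrBr [sigma u * u]mulrC -/(norm sigma u) Nu /z; ring.
have [y Jy] := norm1_ideal_trace sigmaK nil_s generated sqr_d s_dvd_d Jz.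
rewrite Dz normM norm1D.
have -> : norm sigma (sigma u) = 1 by rewrite /norm sigmaK mulrC.
rewrite mul1r -addrA => /addrI /(congr1 (fun t => coef_ga t 1%g)).
have fb := sigma_scalar b.
rewrite coef1_trace traceZ // normM (norm_fix fb) expr2 -mulrA !mulr_algl scalerA.
rewrite coef_gaD !coef_gaZ coef1_trace coef1_s.
by rewrite mulr0 add0r mulr1 => /eqP; rewrite mulf_eq0 orbb => /eqP.
Qed.

(** A fixed [z = b * x + s * r] has trace zero, that is [b * d] is [s] times a
    trace. If [b != 0] then [d = s * t] with [t] in the augmentation ideal, and
    [d ^+ 2 = s ^+ 2 * t ^+ 2 = d ^+ 2 * t ^+ 2] with [t] nilpotent, which forces
    [d ^+ 2 = 0]. *)
Lemma mem_fix_ideal (z : A) : sigma z = z -> (z \in J) = (augmentation z == 0).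
Proof.
move=> fz; apply/idP/eqP => [/imsetP[r _ ->]|z0].
  by rewrite augmentationM augmentation_s mul0r.
have [b [r]] := quadratic_decomposition z; rewrite z0 scale0r add0r => Dz.
have [b0|b_neq0] := eqVneq b 0; first by rewrite Dz b0 scale0r mul0r add0r imset_f.
have fb := sigma_scalar b.
have /eqP := fz; rewrite -(trace_eq0 sigma charA2) {1}Dz traceD.
rewrite !traceZ ?sigma_norm //; last exact: sigmaK.
rewrite addr_eq0 oppr_pchar2 ?charA2 // => /eqP Dd.
pose t : A := b^-1%:A * trace sigma r.
have {}Dd : d = s * t.
  by rewrite /t mulrCA -Dd !mulr_algl scalerA mulVf // scale1r.
have [|u Du] := @augmentation0P t.
  have tr0 : augmentation (trace sigma r : A) = 0.
    by rewrite augmentationD augmentation_sigma addrr_pchar2.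
  by rewrite augmentationM tr0 mulr0.
have Jt : t ^+ 2 \in J.
  have [w Dw] := sqr_x_dvd; rewrite Du exprMn Dw -mulrA; exact: imset_f.
have /eqP[] := sqr_d_neq0; apply: (nil_multiple_eq0 nil_s Jt).
by rewrite {1}Dd exprMn -sqr_d mulrC.
Qed.

(** The permutation [phi] has [(2 ^ n + 2) / 2 = m + 1] orbits on the group, and
    the augmentation maps the fixed subring onto [F]. *)
Lemma card_fix_augmentation0 :
  #|[set z : A | (augmentation z == 0) && (sigma z == z)]| = (#|F| ^ m)%N.
Proof.
set S0 := [set z | _]; pose S := [set z : A | sigma z == z].
have card_gT : #|gT| = (2 ^ n)%N by rewrite -cardsT gT_cycle -ord_a.
have D2 : (2 ^ n = m.*2)%N.
  by rewrite -[n in LHS](@prednK n) ?expnS ?mul2n //; lia.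
have cardS : #|S| = (#|F| ^ m.+1)%N.
  apply: card_linear_extension_fix phiK _.
  by rewrite card_phi_fix card_gT D2 doubleS addn2.
have aug_scal c : augmentation (c%:A : A) = c.
  by rewrite augmentationZ (augmentation_of F 1%g) mulr1.
have aug_onto : @augmentation F gT @: S = setT.
  apply/setP=> c; rewrite inE; apply/imsetP; exists c%:A => //.
  by rewrite inE sigma_scalar.
have F_gt0 : (0 < #|F|)%N by rewrite (cardD1 0).
suff fibres (y : A) : y \in S ->
    #|[set z in S | augmentation z == augmentation y]| = #|S0|.
  have := card_eq_fibres fibres; rewrite aug_onto cardsT cardS expnS => /eqP.
  by rewrite eqn_pmul2l // => /eqP ->.
rewrite inE => /eqP fy; rewrite -(card_imset S0 (addrI y)).
apply: eq_card => z; apply/idP/imsetP => [|[w]]; rewrite !inE.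
  case/andP=> fz /eqP zy; exists ((z : A) - y); last by rewrite addrC subrK.
  rewrite inE (rmorphB sigma) fy (eqP fz) eqxx andbT.
  by rewrite augmentationD -scaleN1r augmentationZ zy mulN1r subrr.
case/andP=> /eqP w0 /eqP fw ->.
by rewrite rmorphD fy fw augmentationD w0 addr0 !eqxx.
Qed.

Lemma card_unitary_subgroup :
  #|@unitary_subgroup F gT (@linear_extension F gT phi)| = (#|F| ^ m)%N.
Proof.
rewrite -card_fix_augmentation0.
transitivity #|[set z in J | sigma z == z]|; last first.
  apply: eq_card => z; rewrite !inE.
  have [fz|] := eqVneq (sigma z) z; last by rewrite !andbF.
  by rewrite mem_fix_ideal.
rewrite -(card_norm1_ideal charA2 sigmaK nil_s generated sqr_d s_dvd_d).
apply: eq_card => u; rewrite !inE.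
apply/idP/idP => [/andP[/andP[Uu /eqP aug_u] /eqP inv_u]|/andP[Ju /eqP Nu]].
  have Nu' : (u : group_algebra F gT) * linear_extension phi u = 1.
    by rewrite inv_u divrr.
  have Nu : norm sigma (u : A) = 1 := Nu'.
  by rewrite norm1_sub_ideal // Nu eqxx.
have Nu' : (u : group_algebra F gT) * linear_extension phi u = 1 := Nu.
have Uu : (u : group_algebra F gT) \is a GRing.unit.
  apply/unitrP; exists (linear_extension phi u); split=> //.
  by rewrite -[RHS]Nu; exact: (mulrC (sigma u) (u : A)).
have inv_u : linear_extension phi u = (u : group_algebra F gT)^-1.
  by apply: (mulrI Uu); rewrite Nu' divrr.
apply/andP; split; last exact/eqP.
apply/andP; split; first exact: Uu.
have [r _ Dr] := imsetP Ju; rewrite -[u](subrK (1 : A)) Dr augmentationD.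
by rewrite augmentationM augmentation_s mul0r add0r (augmentation_of F 1%g).
Qed.
End CyclicTwoGroup.

Theorem lemma3 (F : finFieldType) (charF2 : 2%N \in [pchar F]%R)
    (n : nat) (n_gt2 : 2 < n)
    (gT : finGroupType) (a : gT)
    (gT_cycle : [set: gT] = <[a]>%g) (ord_a : #[a]%g = 2 ^ n)
    (phi : {perm gT}) (phi_aut : phi \in Aut [set: gT])
    (phi_a : phi a = (a ^+ (2 ^ n.-1 - 1))%g) :
  #|@unitary_subgroup F gT (@linear_extension F gT phi)| = #|F| ^ (2 ^ n.-1).
Proof.
have abG : abelian [set: gT] by rewrite gT_cycle cycle_abelian.
exact: (card_unitary_subgroup abG phi_aut charF2 n_gt2 gT_cycle ord_a phi_a).
Qed.
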